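(* Let $n,m,d,q$ be positive integers, let $Q$ be an $n\times m$ incidence matrix, $\xi_0\in\mathbb{R}^{nd}$ a reference configuration, $K=\mathrm{diag}(k_1,\dots,k_m)$ with all $k_i>0$, $R$ a $q\times nd$ matrix, $c^-,c^+\in\mathbb{R}^m$ with $c^-_i<c^+_i$ for all $i$, $T>0$, and let $r:[0,T]\to\mathbb{R}^q$ and $f:[0,T]\to\mathbb{R}^{nd}$ be Lipschitz continuous. Assume: (A1) $\mathrm{rank}\,R=q$; (A2) $\mathrm{Ker}\,(D_{\xi_0}\varphi)\cap\mathrm{Ker}\,R=\{0\}$, equivalently $\mathrm{rank}\begin{pmatrix}(D_{\xi_0}\varphi)^T & R^T\end{pmatrix}=nd$; (A3) $m-nd+q>0$. Suppose there are Lipschitz continuous functions $\zeta:[0,T]\to\mathbb{R}^{nd}$ and $x,\varepsilon,p,\sigma:[0,T]\to\mathbb{R}^m$ such that for all $t\in[0,T]$ \begin{align*} (D_{\xi_0}\varphi)\zeta(t)&=x(t), & R(\zeta(t)+\xi_0)+r(t)&=0, & x(t)&=\varepsilon(t)+p(t),\\ \sigma(t)&=K\varepsilon(t), & (D_{\xi_0}\varphi)^T\big(-\sigma(t)+Hf(t)\big)&\in\mathrm{Im}\,R^T, && \end{align*} and $\sigma(t)\in C$ for all $t$ and $\dot p(t)\in N_C(\sigma(t))$ for almost every $t\in[0,T]$. Then the function $y(t)=\varepsilon(t)+Gr(t)-Ff(t)$ is a solution of the sweeping process \[ -\dot y(t)\in N^K_{\mathcal{C}(t)}(y(t))\ \text{for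 a.e. } t\in[0,T],\qquad y(0)=y_0, \] with moving set $\mathcal{C}(t)=\big(K^{-1}C+Gr(t)-Ff(t)\big)\cap\mathcal{V}$ and initial condition $y_0=K^{-1}\sigma_0+Gr(0)-Ff(0)$, where $\sigma_0=\sigma(0)$.
   Context: $Q$ is an $n\times m$ matrix with entries in $\{0,1,-1\}$ such that each column $i$ contains exactly one entry $1$ (in the row of the origin node of spring $i$) and exactly one entry $-1$ (in the row of its terminus node), all other entries $0$. The vector $\xi_0\in\mathbb{R}^{nd}$ lists node coordinates: $\xi^0_{d(j-1)+k}$ is the $k$-th coordinate of node $j$; it is assumed that the two endpoints of each spring are distinct points. Define $\varphi:\mathbb{R}^{nd}\to\mathbb{R}^m$ by $\varphi_i(\xi)=\sqrt{\sum_{k=1}^d\big(\sum_{j=1}^nQ_{ji}\xi_{d(j-1)+k}\big)^2}$, and let $D_{\xi_0}\varphi$ be its $m\times nd$ Jacobian at $\xi_0$, with entries $(D_{\xi_0}\varphi)_{i,d(j-1)+k}=\mathcal{D}_{ik}Q_{ji}$, where $\mathcal{D}_{ik}=\frac{1}{\varphi_i(\xi_0)}\sum_{\bar j=1}^nQ_{\bar ji}\xi^0_{d(\bar j-1)+k}$. $C=\prod_{i=1}^m[c_i^-,c_i^+]\subset\mathbb{R}^m$. For a nonempty closed convex set $\mathcal{C}\subset\mathbb{R}^m$, $x\in\mathcal{C}$ and a symmetric positive definite matrix $S$, $N^S_{\mathcal{C}}(x)=\{y\in\mathbb{R}^m: y^TS(c-x)\le 0\ \forall c\in\mathcal{C}\}$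 (the $S$-weighted outward normal cone), and $N_{\mathcal{C}}=N^{I}_{\mathcal{C}}$; the notation $N^S_{\mathcal C}(x)$ is used only for $x\in\mathcal C$. A solution of the sweeping process is a Lipschitz function $y$ with $y(t)\in\mathcal{C}(t)$ for all $t$, $y(0)=y_0$, and the differential inclusion holding for a.e. $t$. Write $\begin{pmatrix}(D_{\xi_0}\varphi)^T & R^T\end{pmatrix}^+=\begin{pmatrix}H\\ H'\end{pmatrix}$ for the Moore–Penrose pseudoinverse, with $H$ of size $m\times nd$ and $H'$ of size $q\times nd$. Define the subspaces $\mathcal{U}=\{(D_{\xi_0}\varphi)\zeta:R\zeta=0\}$ and $\mathcal{V}=\{K^{-1}\sigma:(D_{\xi_0}\varphi)^T\sigma\in\mathrm{Im}\,R^T\}$ of $\mathbb{R}^m$. Let $R^+=R^T(RR^T)^{-1}$; let $R_0$ be a matrix whose columns form a basis of $\mathrm{Ker}\,R$; $U=(D_{\xi_0}\varphi)R_0$ (its columns form a basis of $\mathcal U$); $V$ a matrix whose columns form a basis of $\mathcal{V}$; $P_U=(U^TKU)^{-1}U^TK$, $P_V=(V^TKV)^{-1}V^TK$; $G=VP_V(D_{\xi_0}\varphi)R^+$ and $F=UP_UK^{-1}H$. *)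

(* Defs.v *)
From HB Require Import structures.
From mathcomp Require Import all_boot all_order all_algebra.
From mathcomp Require Import all_classical all_reals all_analysis.
Set Implicit Arguments. Unset Strict Implicit. Unset Printing Implicit Defensive.
Import Order.TTheory GRing.Theory Num.Theory.
Import numFieldNormedType.Exports.
Local Open Scope ring_scope.
Local Open Scope classical_set_scope.

Definition incidence_matrix (R : pzRingType) (n m : nat) (Q : 'M[R]_(n, m)) : Prop :=
  forall i : 'I_m, exists j1 j2 : 'I_n,
    [/\ j1 != j2, Q j1 i = 1, Q j2 i = -1 &
        forall j, j != j1 -> j != j2 -> Q j i = 0].

(* decoding of a coordinate index l (0-based) of R^{nd}: l = d*j + k,
   i.e. the paper's index d(j-1)+k with 1-based j, k *)
Lemma node_of_lt (n d : nat) (l : 'I_(n * d)) : (l %/ d < n)%N.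
Proof.
case: l => l /=; case: d => [|d]; first by rewrite muln0.
by move=> Hl; rewrite ltn_divLR.
Qed.
Lemma coord_of_lt (n d : nat) (l : 'I_(n * d)) : (l %% d < d)%N.
Proof.
case: l => l /=; case: d => [|d]; first by rewrite muln0.
by move=> _; rewrite ltn_pmod.
Qed.
Definition node_of (n d : nat) (l : 'I_(n * d)) : 'I_n := Ordinal (node_of_lt l).
Definition coord_of (n d : nat) (l : 'I_(n * d)) : 'I_d := Ordinal (coord_of_lt l).

(* the index d(j-1)+k (paper, 1-based) = d*j + k (0-based) *)
Lemma coord_index_lt (n d : nat) (j : 'I_n) (k : 'I_d) : (j * d + k < n * d)%N.
Proof.
case: j k => j Hj [k Hk] /=.
apply: (@leq_trans (j * d + d)); first by rewrite ltn_add2l.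
by rewrite -[X in (_ + X <= _)%N]mul1n -mulnDl addn1 leq_mul2r Hj orbT.
Qed.
Definition coord_index (n d : nat) (j : 'I_n) (k : 'I_d) : 'I_(n * d) :=
  Ordinal (coord_index_lt j k).

Definition spring_vec (R : pzRingType) (n m d : nat) (Q : 'M[R]_(n, m))
  (xi : 'cV[R]_(n * d)) (i : 'I_m) (k : 'I_d) : R :=
  \sum_(j < n) Q j i * xi (coord_index j k) 0.

Definition phi (R : rcfType) (n m d : nat) (Q : 'M[R]_(n, m))
  (xi : 'cV[R]_(n * d)) (i : 'I_m) : R :=
  Num.sqrt (\sum_(k < d) (spring_vec Q xi i k) ^+ 2).

(* the Jacobian D_{xi0} phi : m x nd, entry (i, d(j-1)+k) = D_{ik} Q_{ji} *)
Definition Dphi (R : rcfType) (n m d : nat) (Q : 'M[R]_(n, m))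
  (xi0 : 'cV[R]_(n * d)) : 'M[R]_(m, n * d) :=
  \matrix_(i, l) ((spring_vec Q xi0 i (coord_of l) / phi Q xi0 i) * Q (node_of l) i).

Definition is_MP_pinv (R : fieldType) (a b : nat) (A : 'M[R]_(a, b)) (X : 'M[R]_(b, a))
  : Prop :=
  [/\ A *m X *m A = A, X *m A *m X = X, (A *m X)^T = A *m X & (X *m A)^T = X *m A].

Definition col_basis (R : fieldType) (p s : nat) (B : 'M[R]_(p, s))
  (S : set 'cV[R]_p) : Prop :=
  [/\ forall j : 'I_s, S (col j B), \rank B = s &
      forall v, S v -> exists a : 'cV[R]_s, v = B *m a].

Definition kerS (R : pzRingType) (a b : nat) (A : 'M[R]_(a, b)) : set 'cV[R]_b :=
  [set z | A *m z = 0].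

Definition imS (R : pzRingType) (a b : nat) (A : 'M[R]_(a, b)) : set 'cV[R]_a :=
  [set v | exists z, v = A *m z].

Definition boxC (R : realDomainType) (m : nat) (cm cp : 'cV[R]_m) : set 'cV[R]_m :=
  [set y | forall i, cm i 0 <= y i 0 <= cp i 0].

Definition normal_cone (R : realDomainType) (m : nat) (S : 'M[R]_m)
  (Cs : set 'cV[R]_m) (x : 'cV[R]_m) : set 'cV[R]_m :=
  [set y | forall c, Cs c -> (y^T *m S *m (c - x)) 0 0 <= 0].

(* Lipschitz continuity on [0,T] (w.r.t. the matrix norm; all norms equivalent) *)
Definition lipschitz_0T (R : realType) (p s : nat) (T : R) (g : R -> 'M[R]_(p, s)) : Prop :=
  exists L : R, forall t1 t2, 0 <= t1 <= T -> 0 <= t2 <= T ->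
    `|g t1 - g t2| <= L * `|t1 - t2|.

Definition sweeping_solution (R : realType) (m : nat) (T : R) (S : 'M[R]_m)
  (Cmov : R -> set 'cV[R]_m) (y0 : 'cV[R]_m) (y : R -> 'cV[R]_m) : Prop :=
  [/\ lipschitz_0T T y,
      forall t, 0 <= t <= T -> Cmov t (y t),
      y 0 = y0 &
      {ae (@lebesgue_measure R), forall t, 0 <= t <= T ->
         derivable y t 1 /\ normal_cone S (Cmov t) (y t) (- 'D_1 y t)}].

(* Main.v *)
(* In the K-weighted inner product the subspace Vset is the orthogonal complement
   of U = Im (Dp R0), and E = V PV is the orthogonal projection onto it.
   Equilibrium puts y(t) in Vset, so y = E y; the constraint R (zeta + xi0) = - r
   makes eps + p + Dp xi0 + Dp R^+ r lie in U, which E kills.  Hence on [0, T]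
     y = - E p - E Dp xi0,
   so y is differentiable wherever p is, with y' = - E p', and no differentiability
   of r or f is needed.  Since K E = E^T K and E fixes Vset, for c in the moving set
   the pairing of - y' with c - y equals p'^T K (c - y) = p'^T (c' - sigma) with
   c' in C, which is nonpositive by the flow rule. *)
Require Import Defs.
From HB Require Import structures.
From mathcomp Require Import all_boot all_order all_algebra.
From mathcomp Require Import all_classical all_reals all_analysis.
Import Order.TTheory GRing.Theory Num.Theory.
Import numFieldNormedType.Exports.
Local Open Scope ring_scope.
Local Open Scope classical_set_scope.

(** * Positive diagonal weights and invertible Gram matrices *)

Lemma diag_mx_unit {F : numFieldType} {m : nat} {k : 'rV[F]_m} :
  (forall i, 0 < k 0 i) -> diag_mx k \in unitmx.
Proof.
move=> k_gt0; rewrite unitmxE det_diag unitfE.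
by apply/prodf_neq0 => i _; rewrite gt_eqF.
Qed.

(** The form is the sum of the terms [k 0 i * w i 0 ^+ 2]; each is nonnegative, so each vanishes. *)
Lemma diag_form_eq0 {F : realFieldType} {m : nat} {k : 'rV[F]_m} (w : 'cV[F]_m) :
  (forall i, 0 < k 0 i) -> w^T *m diag_mx k *m w = 0 -> w = 0.
Proof.
move=> k_gt0 /matrixP /(_ 0 0); rewrite mxE [RHS]mxE.
under eq_bigr => i _ do rewrite mul_mx_diag !mxE mulrAC -expr2.
move=> /eqP; rewrite psumr_eq0 => [/allP w0|i _]; last first.
  by rewrite mulr_ge0 ?sqr_ge0// ltW.
apply/matrixP => i j; rewrite (ord1 j) [RHS]mxE.
have /= := w0 i (mem_index_enum _).
by rewrite mulf_eq0 (gt_eqF (k_gt0 i)) orbF sqrf_eq0 => /eqP.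
Qed.

(** A row vector [v] killed by the Gram matrix makes the quadratic form vanish at [V *m v^T];
    definiteness and injectivity then give [v = 0]. *)
Lemma gram_unit {F : realFieldType} {m s : nat} {k : 'rV[F]_m} (V : 'M[F]_(m, s)) :
  (forall i, 0 < k 0 i) -> (forall v : 'cV[F]_s, V *m v = 0 -> v = 0) ->
  V^T *m diag_mx k *m V \in unitmx.
Proof.
move=> k_gt0 V_inj; rewrite -row_free_unit; apply: inj_row_free => v v0.
apply/trmx_inj; rewrite trmx0; apply: V_inj; apply: (diag_form_eq0 _ k_gt0).
by rewrite trmx_mul trmxK -[RHS](mul0mx _ v^T) -v0 !mulmxA.
Qed.

Lemma col_inj_rank {F : fieldType} {m s : nat} {V : 'M[F]_(m, s)} :
  \rank V = s -> forall v : 'cV[F]_s, V *m v = 0 -> v = 0.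
Proof.
move=> rV v Vv0; apply/trmx_inj; rewrite trmx0.
apply: (row_free_inj (A := V^T)); first by rewrite /row_free mxrank_tr rV.
by rewrite mul0mx -trmx_mul Vv0 trmx0.
Qed.

(** * Weighted projections and orthogonal complements *)

(* The K-orthogonal projection onto the column space of V, e.g. U PU and V PV. *)
Definition wproj {F : fieldType} {m s : nat} (K : 'M[F]_m) (V : 'M[F]_(m, s)) : 'M[F]_m :=
  V *m (invmx (V^T *m K *m V) *m V^T *m K).

Lemma wproj_id {F : fieldType} {m s : nat} {K : 'M[F]_m} {V : 'M[F]_(m, s)} :
  V^T *m K *m V \in unitmx -> wproj K V *m V = V.
Proof. by move=> uV; rewrite /wproj -!mulmxA (mulmxA V^T) mulVmx// mulmx1. Qed.

Lemma mul_wproj {F : fieldType} {m s : nat} {K : 'M[F]_m} {V : 'M[F]_(m, s)} :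
  V^T *m K *m V \in unitmx -> V^T *m K *m wproj K V = V^T *m K.
Proof. by move=> uV; rewrite /wproj !mulmxA mulmxV// mul1mx. Qed.

(** Self-adjointness for the inner product of [K]; it later moves the projection across the pairing
    in the normal cone. *)
Lemma wproj_adj {F : fieldType} {m s : nat} {K : 'M[F]_m} (V : 'M[F]_(m, s)) :
  K^T = K -> (wproj K V)^T *m K = K *m wproj K V.
Proof.
move=> KT; rewrite /wproj !trmx_mul trmx_inv !trmx_mul trmxK KT.
by rewrite !mulmxA.
Qed.

Lemma wproj_eq0 {F : fieldType} {m s u : nat} {K : 'M[F]_m} {V : 'M[F]_(m, s)}
    {W : 'M[F]_(m, u)} :
  V^T *m K *m W = 0 -> wproj K V *m W = 0.
Proof. by move=> VW; rewrite /wproj -!mulmxA (mulmxA V^T K W) VW !mulmx0. Qed.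

(* Im A^T is the orthogonal complement of Ker A. *)
Lemma imS_trmxP {F : fieldType} {a b s : nat} {A : 'M[F]_(a, b)} {B : 'M[F]_(b, s)}
    (w : 'cV[F]_b) :
  col_basis B (kerS A) -> imS A^T w <-> B^T *m w = 0.
Proof.
move=> [BA _ kerB]; have AB : A *m B = 0.
  apply/matrixP => i j.
  have /matrixP /(_ i 0) := BA j.
  by rewrite !mxE; under eq_bigr do rewrite mxE.
split=> [[z ->]|Bw]; first by rewrite mulmxA -trmx_mul AB trmx0 mul0mx.
suff /submxP[z wz] : (w^T <= A)%MS.
  by exists z^T; rewrite -trmx_mul -wz trmxK.
(* The columns of [cokermx A] lie in [Ker A], hence in the span of [B], so [w^T] annihilates
   them. *)
rewrite submxE; apply/eqP/matrixP => i j.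
have [|c colc] := kerB (col j (cokermx A)).
  by rewrite /kerS/= colE mulmxA mulmx_coker mul0mx.
transitivity ((w^T *m col j (cokermx A)) i 0).
  by rewrite colE mulmxA -colE [RHS]mxE.
by rewrite colc mulmxA -[w^T *m B]trmxK trmx_mul trmxK Bw trmx0 mul0mx !mxE.
Qed.

(** * Analysis of multiplication by a constant matrix *)

Lemma mulmx_norm_le {R : realFieldType} {a b c : nat} (A : 'M[R]_(a, b)) :
  exists2 M : R, 0 <= M & forall v : 'M[R]_(b, c), `|A *m v| <= M * `|v|.
Proof.
(* The norm is the largest absolute value of an entry, so the sum over all entries of [A] is a
   sufficient constant. *)
exists (\sum_(i < a) \sum_(j < b) `|A i j|) => [|v].
  by do 2!apply: sumr_ge0 => ? _.
have v_ge j l : `|v j l| <= `|v|.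
  by rewrite [leRHS]/Num.norm/= mx_normrE (le_bigmax _ _ (j, l)).
rewrite [leLHS]/Num.norm/= mx_normrE; apply/bigmax_leP; split=> [|[i l] _ /=].
  by rewrite mulr_ge0//; do 2!apply: sumr_ge0 => ? _.
rewrite mxE (le_trans (ler_norm_sum _ _ _))// (bigD1 i)//= mulrDl.
rewrite -[leLHS]addr0 lerD//; last first.
  by rewrite mulr_ge0//; do 2!apply: sumr_ge0 => ? _.
rewrite mulr_suml; apply: ler_sum => j _.
by rewrite normrM ler_wpM2l.
Qed.

Lemma mulmx_continuous {R : realFieldType} {a b c : nat} (A : 'M[R]_(a, b)) :
  continuous (mulmx A : 'M[R]_(b, c) -> 'M[R]_(a, c)).
Proof.
have [M M_ge0 AM] := @mulmx_norm_le R a b c A.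
(* [M] may be [0], while [M + 1] can serve as a divisor. *)
have M1_gt0 : 0 < M + 1 by rewrite ltr_wpDl.
move=> v; apply: (cvgrPdist_le (F := nbhs v) _ _).2 => /= e e_gt0; near=> w.
rewrite -mulmxBr (le_trans (AM _))//.
rewrite (@le_trans _ _ ((M + 1) * `|v - w|))//.
  by rewrite ler_wpM2r// lerDl.
rewrite -ler_pdivlMl// mulrC; near: w.
have /cvgrPdist_le : id w @[w --> v] --> v by exact: cvg_id.
by apply; rewrite divr_gt0.
Unshelve. all: by end_near. Qed.

Lemma derive_affine_mx {R : realFieldType} {a b c : nat} (A : 'M[R]_(a, b))
    (B : 'M[R]_(a, c)) {g : R -> 'M[R]_(b, c)} {t : R} :
  derivable g t 1 ->
  derivable (fun s => A *m g s + B) t 1 /\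
  'D_1 (fun s => A *m g s + B) t = A *m 'D_1 g t.
Proof.
move=> dg.
(* The constant [B] cancels in the difference quotient, and continuity of [mulmx A] passes to the
   limit. *)
have h : h^-1 *: (A *m g (h *: 1 + t) + B - (A *m g t + B)) @[h --> 0^'] -->
    A *m 'D_1 g t.
  under eq_fun do rewrite opprD addrACA subrr addr0 -mulmxBr scalemxAr.
  have dl : h^-1 *: (g (h *: 1 + t) - g t) @[h --> 0^'] --> 'D_1 g t by exact: dg.
  by have := @cvg_comp _ _ _ _ (mulmx A) _ _ _ dl (mulmx_continuous A _); apply.
by split; [apply/cvg_ex; eexists; exact: h | exact/cvg_lim].
Qed.

Lemma lipschitz_0T_mulmx {R : realType} {a b c : nat} {T : R} (A : 'M[R]_(a, b))
    {g : R -> 'M[R]_(b, c)} :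
  lipschitz_0T T g -> lipschitz_0T T (fun t => A *m g t).
Proof.
have [M M_ge0 AM] := @mulmx_norm_le R a b c A.
move=> [L gL]; exists (M * L) => t1 t2 t1T t2T.
by rewrite -mulmxBr (le_trans (AM _))// -mulrA ler_wpM2l// gL.
Qed.

Lemma lipschitz_0TD {R : realType} {a b : nat} {T : R} {g h : R -> 'M[R]_(a, b)} :
  lipschitz_0T T g -> lipschitz_0T T h -> lipschitz_0T T (fun t => g t + h t).
Proof.
move=> [L gL] [M hM]; exists (L + M) => t1 t2 t1T t2T.
by rewrite opprD addrACA (le_trans (ler_normD _ _))// mulrDl lerD// ?gL ?hM.
Qed.

Lemma lipschitz_0TN {R : realType} {a b : nat} {T : R} {g : R -> 'M[R]_(a, b)} :
  lipschitz_0T T g -> lipschitz_0T T (fun t => - g t).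
Proof.
move=> [L gL]; exists L => t1 t2 t1T t2T.
by rewrite -opprD normrN gL.
Qed.

Lemma ae_neq {R : realType} (a : R) : {ae (@lebesgue_measure R), forall t, t != a}.
Proof.
exists [set a]; split => //; first exact: lebesgue_measure_set1.
by move=> t /=; case: eqP.
Qed.

(** * From the elastoplastic system to the sweeping process *)

Theorem theorem5 (R : realType) (n m d q : nat)
  (n_gt0 : (0 < n)%N) (m_gt0 : (0 < m)%N) (d_gt0 : (0 < d)%N) (q_gt0 : (0 < q)%N)
  (Q : 'M[R]_(n, m)) (HQ : incidence_matrix Q)
  (xi0 : 'cV[R]_(n * d)) (Hxi0 : forall i : 'I_m, phi Q xi0 i != 0)
  (k : 'rV[R]_m) (Hk : forall i, 0 < k 0 i)
  (Rm : 'M[R]_(q, n * d))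
  (cm cp : 'cV[R]_m) (Hc : forall i, cm i 0 < cp i 0)
  (T : R) (HT : 0 < T)
  (r : R -> 'cV[R]_q) (f : R -> 'cV[R]_(n * d))
  (Hr : lipschitz_0T T r) (Hf : lipschitz_0T T f)
  (A1 : \rank Rm = q)
  (A2 : forall z : 'cV[R]_(n * d), Dphi Q xi0 *m z = 0 -> Rm *m z = 0 -> z = 0)
  (A3 : (n * d < m + q)%N)
  (Pinv : 'M[R]_(m + q, n * d))
  (HPinv : is_MP_pinv (row_mx (Dphi Q xi0)^T Rm^T) Pinv)
  (s0 : nat) (R0 : 'M[R]_(n * d, s0)) (HR0 : col_basis R0 (kerS Rm))
  (sV : nat) (V : 'M[R]_(m, sV))
  (HV : col_basis V [set v | exists sig : 'cV[R]_m,
          v = invmx (diag_mx k) *m sig /\ imS Rm^T ((Dphi Q xi0)^T *m sig)])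
  (zeta : R -> 'cV[R]_(n * d)) (x eps p sigma : R -> 'cV[R]_m)
  (Hzeta : lipschitz_0T T zeta) (Hx : lipschitz_0T T x) (Heps : lipschitz_0T T eps)
  (Hp : lipschitz_0T T p) (Hsigma : lipschitz_0T T sigma) :
  let Dp := Dphi Q xi0 in
  let K := diag_mx k in
  let H : 'M[R]_(m, n * d) := usubmx Pinv in
  let C := boxC cm cp in
  let Vset := [set v | exists sig : 'cV[R]_m,
          v = invmx K *m sig /\ imS Rm^T (Dp^T *m sig)] in
  let Rplus := Rm^T *m invmx (Rm *m Rm^T) in
  let U := Dp *m R0 in
  let PU := invmx (U^T *m K *m U) *m U^T *m K in
  let PV := invmx (V^T *m K *m V) *m V^T *m K in
  let G := V *m PV *m Dp *m Rplus in
  let F := U *m PU *m invmx K *m H in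
  (forall t, 0 <= t <= T ->
     [/\ Dp *m zeta t = x t,
         Rm *m (zeta t + xi0) + r t = 0,
         x t = eps t + p t,
         sigma t = K *m eps t &
         imS Rm^T (Dp^T *m (- sigma t + H *m f t))] /\
     C (sigma t)) ->
  {ae (@lebesgue_measure R), forall t, 0 <= t <= T ->
     derivable p t 1 /\ normal_cone 1%:M C (sigma t) ('D_1 p t)} ->
  let Cmov := fun t => [set v | exists c, C c /\ v = invmx K *m c + G *m r t - F *m f t]
                       `&` Vset in
  let y0 := invmx K *m sigma 0 + G *m r 0 - F *m f 0 in
  sweeping_solution T K Cmov y0 (fun t => eps t + G *m r t - F *m f t).
Proof.
have K_unit : diag_mx k \in unitmx := diag_mx_unit Hk.
have KT : (diag_mx k)^T = diag_mx k by rewrite tr_diag_mx.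
have gramK s (W : 'M[R]_(m, s)) := gram_unit W Hk.
(* A Gram matrix with unit weights: full row rank of [Rm] makes [Rm^T] injective. *)
have RRt : Rm *m Rm^T \in unitmx.
  have := @gram_unit _ _ _ (const_mx 1) Rm^T.
  rewrite diag_const_mx mulmx1 trmxK; apply=> [i|]; first by rewrite mxE.
  by apply: col_inj_rank; rewrite mxrank_tr.
clear HPinv; move: A2 HV K_unit KT gramK.
move: (Dphi Q xi0) (diag_mx k) (usubmx Pinv) => Dp K H {}A2 HV K_unit KT gramK.
move=> Dp' K' H' C Vset Rplus U PU PV G F sol flow Cmov y0; subst Dp' K' H'.
have UE : U = Dp *m R0 by [].
have RplusE : Rm *m Rplus = 1%:M by rewrite mulmxA mulmxV.
have GE : G = wproj K V *m (Dp *m Rplus) by rewrite /G /PV /wproj !mulmxA.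
have FE : F = wproj K U *m (invmx K *m H) by rewrite /F /PU /wproj !mulmxA.
clearbody G F Rplus U; clear PU PV.
(* Since [Im Rm^T] is the orthogonal complement of [Im R0], membership in [Vset] is
   [K]-orthogonality to the columns of [U]. *)
have VsetP v : Vset v <-> U^T *m K *m v = 0.
  have -> : U^T *m K *m v = R0^T *m (Dp^T *m (K *m v)).
    by rewrite UE trmx_mul !mulmxA.
  rewrite -(imS_trmxP _ HR0); split=> [[sig [-> ?]]|?].
    by rewrite mulKVmx.
  by exists (K *m v); rewrite mulKmx.
have [VV rV Vspan] := HV.
have uV : V^T *m K *m V \in unitmx by exact: gramK _ _ (col_inj_rank rV).
have RR0 : Rm *m R0 = 0.
  apply/matrixP => i j; case: HR0 => /(_ j) /matrixP /(_ i 0) + _ _.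
  by rewrite !mxE; under eq_bigr do rewrite mxE.
(* If [U *m v = 0], then [R0 *m v] lies in both kernels of [A2], hence is zero. *)
have uU : U^T *m K *m U \in unitmx.
  apply: gramK => v; rewrite UE -mulmxA => Uv0.
  have [_ rR0 _] := HR0; apply: (col_inj_rank rR0).
  by apply: A2 => //; rewrite mulmxA RR0 mul0mx.
have UKV : U^T *m K *m V = 0.
  apply/matrixP => i j; have /VsetP /matrixP /(_ i 0) := VV j.
  by rewrite colE mulmxA -colE !mxE.
have VKU : V^T *m K *m U = 0.
  by apply: trmx_inj; rewrite !trmx_mul trmxK KT mulmxA UKV trmx0.
pose E := wproj K V; rewrite -/E in GE.
have EU : E *m U = 0 by exact: wproj_eq0.
have EE : E *m E = E by rewrite {2}/E /wproj mulmxA wproj_id.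
have Eid v : Vset v -> E *m v = v.
  by move=> /Vspan[c ->]; rewrite mulmxA wproj_id.
have UKE : U^T *m K *m E = 0 by rewrite /E /wproj mulmxA UKV mul0mx.
have EK : E^T *m K = K *m E := wproj_adj V KT.
clearbody E.
(* Tested against [U], the term in [G] disappears and the term in [F] reproduces the load
   [U^T *m H]; under [E], conversely, [G] is fixed and [F] is killed. *)
have UKG : U^T *m K *m G = 0 by rewrite GE mulmxA UKE mul0mx.
have UKF : U^T *m K *m F = U^T *m H.
  by rewrite FE mulmxA mul_wproj// -!mulmxA mulKVmx.
have EG : E *m G = G by rewrite GE mulmxA EE.
have EF : E *m F = 0 by rewrite FE /wproj -!mulmxA (mulmxA E U) EU mul0mx.
pose y t := eps t + G *m r t - F *m f t.
have yV t : 0 <= t <= T -> Vset (y t).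
  (* Equilibrium says that [U^T] sends [sigma t] and [H *m f t] to the same vector, so
     [U^T *m K *m y t] vanishes. *)
  move=> /sol[[_ _ _ sE]] + _; rewrite (imS_trmxP _ HR0) mulmxA.
  rewrite -trmx_mul -UE mulmxDr mulmxN sE => Us.
  apply/VsetP; rewrite /y mulmxBr mulmxDr !mulmxA UKG UKF mul0mx addr0.
  by apply/eqP; rewrite -oppr_eq0 opprB addrC -!mulmxA Us.
have yE t : 0 <= t <= T -> y t = - E *m p t - E *m Dp *m xi0.
  move=> tT; have [[Dz Rz xE _ _] _] := sol t tT.
  have [_ _ kerR0] := HR0.
  (* Adding [Rplus *m r t] turns the affine constraint into membership in [Ker Rm]. *)
  have [c zc] : exists c, zeta t + xi0 + Rplus *m r t = R0 *m c.
    apply: kerR0; rewrite /kerS/= mulmxDr mulmxA RplusE.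
    by rewrite mul1mx.
  have : E *m Dp *m (zeta t + xi0 + Rplus *m r t) = 0.
    by rewrite zc mulmxA -(mulmxA E) -UE EU mul0mx.
  rewrite !mulmxDr -(mulmxA E Dp (zeta t)) Dz xE mulmxDr => e0.
  (* Replacing [y t] by [E *m y t] removes the term in [f]; the term in [r] matches the one in
     [e0]. *)
  rewrite -(Eid _ (yV t tT)) /y mulmxBr mulmxDr !(mulmxA E) EG EF mul0mx subr0 GE.
  apply/eqP; rewrite -subr_eq0; apply/eqP; rewrite -[RHS]e0.
  rewrite !mulmxA mulNmx opprB opprK [X in _ + X = _]addrC addrACA -[RHS]addrA.
  by congr (_ + _); exact: addrC.
split.
- apply: lipschitz_0TD; last exact/lipschitz_0TN/lipschitz_0T_mulmx.
  by apply: lipschitz_0TD => //; exact: lipschitz_0T_mulmx.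
- move=> t tT; split; last exact: yV.
  exists (sigma t); have [[_ _ _ sE _] ?] := sol t tT; split=> //.
  by rewrite sE mulKmx.
- have T0 : 0 <= (0 : R) <= T by rewrite lexx ltW.
  by have [[_ _ _ sE _] _] := sol 0 T0; rewrite /y0 sE mulKmx.
(* The endpoints are discarded: y is only controlled on [0, T], while the derivative
   is two-sided. *)
- move: flow; apply: (@filterS3 _ _ (ae_filter_ringOfSetsType _) _ _ _ _ _
    (ae_neq 0) (ae_neq T)) => t t0 tT + tI.
  move=> /(_ tI)[dp Np].
  have [dEp EDp] := derive_affine_mx (- E) (- (E *m Dp *m xi0)) dp.
  have tI' : t \in `]0, T[%R.
    by rewrite in_itv/= lt_neqAle eq_sym t0 lt_neqAle tT /=.
  (* The formula for [y] holds on a whole neighbourhood of the interior point [t], so derivatives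
     can be compared. *)
  have near_y : {near t, (fun s => - E *m p s - E *m Dp *m xi0) =1 y}.
    near=> s; rewrite yE//.
    have : s \in `]0, T[%R by near: s; exact: near_in_itvoo.
    by rewrite in_itv/= => /andP[/ltW-> /ltW->].
  split; first exact: near_eq_derivable dEp.
  have -> : 'D_1 y t = - (E *m 'D_1 p t).
    by rewrite -(near_eq_derive _ near_y) EDp mulNmx.
  move=> c [[c' [Cc' cE]] /Eid Ec].
  have Ey := Eid _ (yV t tI).
  have [[_ _ _ sE _] _] := sol t tI.
  (* Both points carry the same translation by [G *m r t - F *m f t], which cancels. *)
  have Kc : K *m (c - y t) = c' - sigma t.
    rewrite cE /y opprB addrA subrK opprD addrACA subrr addr0.
    by rewrite mulmxBr mulKVmx// sE.
  rewrite opprK trmx_mul -(mulmxA _ E^T) EK -!mulmxA.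
  rewrite mulmxBr Ec Ey Kc.
  by have := Np c' Cc'; rewrite mulmx1.
Unshelve. all: by end_near. Qed.
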